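(* Let $u$ be the solution of the $L$-periodic initial value problem for the Benjamin-Bona-Mahony-Burgers equation, $U_i^k=u(x_i,t_k)$, $V_i^k=u_{xx}(x_i,t_k)$, and let $c_0,c_1,c_2,c_3$ be the constants described in the context (so that $\{U_i^k,V_i^k\}$ satisfies the perturbed difference equations given in the context). Let $\{u_i^k,v_i^k \mid 1\le i\le M,\ 0\le k\le N\}$ be the solution of the compact difference scheme given in the context. Denote $$e_i^k=U_i^k-u_i^k,\qquad f_i^k=V_i^k-v_i^k,\qquad 1\le i\le M,\ 0\le k\le N.$$ Then there exist positive constants $h_0,\tau_0$ such that, when $h\le h_0$, $\tau\le\tau_0$ and $\tau^2+h^4\le 1/c_4$, $$|e^k|_1\le c_4(\tau^2+h^4),\qquad 0\le k\le N,$$ where $c_4=\max\{\sqrt{c_5/\mu},\ \sqrt{2c_{10}}\}$ with $$c_5=\Big[\tfrac{27}{4}\big(\tfrac{\nu\tau_0}{2}-\mu\big)^2+\tfrac{3\kappa^2h_0^2\tau_0^2}{16}+\tfrac{3\gamma^2c_0^2\tau_0^2h_0^2(h_0+1)^2}{4}+\tfrac{\mu h_0^2}{16}+\tfrac{\nu h_0^2\tau_0}{32}+\tfrac32\big(\mu+\tfrac{\nu\tau_0}{2}\big)^2+\tfrac{\kappa^2h_0^4\tau_0^2}{576\mu}+\tfrac{\kappa^2h_0^2\tau_0^2}{24}\Big]Lc_3^2+\tfrac{3Lc_1^2}{2},$$ $$c_6=\tfrac{5\gamma^2(Lc_0+\sqrt L)^2}{8}+\tfrac{5\gamma^2}{8}\Big(\tfrac{Lc_0h_0^2}{2}+\tfrac{3\sqrt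 L}{2}\sqrt{8+2Lc_3^2h_0^{10}}\Big)^2+\tfrac{5\kappa^2}{2}+\tfrac{10\kappa^2}{9}+\tfrac{5\gamma^2(Lc_0+c_0)^2}{18},$$ $$c_7=5\gamma^2(h_0c_0+c_0)^2+\tfrac{3\kappa^2h_0^2}{16\mu}+\tfrac{\kappa^2h_0^2}{48\mu}+\tfrac{\kappa^2h_0^4}{72}+\tfrac{\nu^2h_0^2}{8},$$ $$c_8=\Big(\tfrac{3\mu h_0^2}{32}+\tfrac{5\mu^2}{2}+\tfrac12+\tfrac{5\kappa^2h_0^2}{18}+\tfrac{5\nu^2}{2}\Big)Lc_3^2+\tfrac{5Lc_2^2}{2},$$ $$c_9=\max\{c_6,c_7,c_8\},\qquad c_{10}=\exp\Big(\tfrac{6Tc_9}{\nu}\Big)\Big(\tfrac{5c_5}{4\mu}+\tfrac{3h_0^2Lc_3^2}{8}+\tfrac12\Big).$$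
   Context: Continuous problem. $u_t-\mu u_{xxt}+\gamma uu_x+\kappa u_x-\nu u_{xx}=0$ for $x\in\mathbb R$, $0<t\le T$; $u(x,t)=u(x+L,t)$; $u(x,0)=\varphi(x)$. Here $\mu$ and $\gamma$ are non-negative constants, $\kappa$ and $\nu$ are (real) parameters, $L$ is the spatial period. The solution $u$ is assumed smooth enough that the constants $c_0,\dots,c_3$ below exist. Grid. $M,N$ are positive integers, $h=L/M$, $\tau=T/N$, $x_i=ih$ ($i\in\mathbb Z$), $t_k=k\tau$ ($0\le k\le N$). Notation for grid functions: $\delta_xu_{i+1/2}=\frac1h(u_{i+1}-u_i)$, $\delta_x^2u_i=\frac1{h^2}(u_{i+1}-2u_i+u_{i-1})$, $\Delta_xu_i=\frac1{2h}(u_{i+1}-u_{i-1})$, $u^{k+1/2}=\frac12(u^k+u^{k+1})$, $u^{\bar k}=\frac12(u^{k-1}+u^{k+1})$, $\delta_tu^{k+1/2}=\frac1\tau(u^{k+1}-u^k)$, $\Delta_tu^k=\frac1{2\tau}(u^{k+1}-u^{k-1})$, and $\psi(u,v)_i=\frac13[u_i\Delta_xv_i+\Delta_x(uv)_i]$. For an $M$-periodic grid function $u$ ($u_{i+M}=u_i$), $|u|_1=\big(h\sum_{i=1}^M(\delta_xu_{i-1/2})^2\big)^{1/2}$. Compact difference scheme. Grid functions $u_i^k,v_i^k$, $M$-periodic in $i$, with $u_i^0=\varphi(x_i)$ and, for $1\le i\le M$: (1) $\delta_tu_i^{1/2}-\mu\delta_tv_i^{1/2}+\gamma\big[\psi(u^0,u^{1/2})_i-\frac{h^2}2\psi(v^0,u^{1/2})_i\big]+\kappa\big(\Delta_xu_i^{1/2}-\frac{h^2}6\Delta_xv_i^{1/2}\big)-\nu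 v_i^{1/2}=0$; (2) $\Delta_tu_i^k-\mu\Delta_tv_i^k+\gamma\big[\psi(u^k,u^{\bar k})_i-\frac{h^2}2\psi(v^k,u^{\bar k})_i\big]+\kappa\big(\Delta_xu_i^{\bar k}-\frac{h^2}6\Delta_xv_i^{\bar k}\big)-\nu v_i^{\bar k}=0$ for $1\le k\le N-1$; (3) $v_i^k=\delta_x^2u_i^k-\frac{h^2}{12}\delta_x^2v_i^k$ for $0\le k\le N$. Perturbed equations and constants. $c_0=\max_{0\le x\le L,\,0\le t\le T}\{|u|,|u_x|,|u_{xx}|,|u_{xxx}|\}$. The exact values $U_i^k=u(x_i,t_k)$, $V_i^k=u_{xx}(x_i,t_k)$ are $M$-periodic in $i$, satisfy $U_i^0=\varphi(x_i)$, and satisfy (1), (2), (3) (with $u,v$ replaced by $U,V$) with an additional term $Q_i^0$, $Q_i^k$ ($1\le k\le N-1$), $R_i^k$ ($0\le k\le N$), respectively, added to the right-hand side; $c_1,c_2,c_3$ are positive constants (independent of $h,\tau$) such that $|Q_i^0|\le c_1(\tau+h^4)$, $|Q_i^k|\le c_2(\tau^2+h^4)$ for $1\le k\le N-1$, and $|R_i^k|\le c_3h^4$ for $0\le k\le N$ ($1\le i\le M$). *)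

(* Defs.v *)
From HB Require Import structures.
From mathcomp Require Import all_boot all_order all_algebra.
From mathcomp Require Import all_classical all_reals all_analysis.
Set Implicit Arguments.
Unset Strict Implicit.
Unset Printing Implicit Defensive.
Import Order.TTheory GRing.Theory Num.Theory.
Import numFieldNormedType.Exports.
Local Open Scope classical_set_scope.
Local Open Scope ring_scope.

(* The n-th partial derivative in x of u = u(x, t). *)
Definition dx {R : realType} (n : nat) (u : R -> R -> R) (x t : R) : R :=
  derive1n n (u^~ t) x.

(* Derivative relative to the time interval [0, T]: two-sided in ]0, T[ and
   one-sided at the end points, so that u need not extend beyond t = T. *)
Definition is_time_derivative {R : realType} (T : R) (g : R -> R) (t l : R) :
    Prop :=
  (g s - g t) / (s - t) @[s --> within [set s | 0 <= s <= T] t^'] --> l.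

(* Classical solution of the L-periodic initial value problem
     u_t - mu u_xxt + gamma u u_x + kappa u_x - nu u_xx = 0,  0 < t <= T,
   where u_xxt is the time derivative of u_xx; three x-derivatives are required
   because u_xxx enters the constant c0. *)
Record is_bbmb_solution {R : realType} (L T mu gamma kappa nu : R)
    (phi : R -> R) (u : R -> R -> R) : Prop := {
  bbmb_continuous :
    {within [set p : R * R | 0 <= p.2 <= T], continuous (fun p => u p.1 p.2)};
  bbmb_smooth : forall (n : nat) (x t : R), (n < 3)%N -> 0 <= t <= T ->
    derivable (fun y => dx n u y t) x 1;
  bbmb_equation : forall x t : R, 0 < t <= T ->
    exists ut uxxt : R,
      [/\ is_time_derivative T (u x) t ut,
          is_time_derivative T (dx 2 u x) t uxxt &
          ut - mu * uxxt + gamma * (u x t * dx 1 u x t) + kappa * dx 1 u x t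
            - nu * dx 2 u x t = 0];
  bbmb_periodic : forall x t : R, 0 <= t <= T -> u (x + L) t = u x t;
  bbmb_initial : forall x : R, u x 0 = phi x }.

(* c0 is the (attained) maximum of |u|, |u_x|, |u_xx|, |u_xxx| over
   [0, L] x [0, T]. *)
Definition is_derivative_max {R : realType} (L T : R) (u : R -> R -> R)
    (c0 : R) : Prop :=
  let A := [set y | exists (n : nat) (x t : R),
    [/\ (n <= 3)%N, 0 <= x <= L, 0 <= t <= T & y = `|dx n u x t|]] in
  A c0 /\ ubound A c0.

(* Grid functions are indexed by all integers; periodicity is imposed
   separately.  A space-time grid function is u : nat -> int -> R, with
   u k i standing for u_i^k. *)
Definition grid_periodic {R : realType} (M : nat) (w : int -> R) : Prop :=
  forall i : int, w (i + M%:Z) = w i.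

(* delta_x w_{i+1/2}, stored at the index i. *)
Definition deltax {R : realType} (h : R) (w : int -> R) (i : int) : R :=
  (w (i + 1) - w i) / h.

Definition deltax2 {R : realType} (h : R) (w : int -> R) (i : int) : R :=
  (w (i + 1) - 2 * w i + w (i - 1)) / h ^+ 2.

(* The centred difference Delta_x. *)
Definition cdiffx {R : realType} (h : R) (w : int -> R) (i : int) : R :=
  (w (i + 1) - w (i - 1)) / (2 * h).

Definition psi {R : realType} (h : R) (w z : int -> R) (i : int) : R :=
  1 / 3 * (w i * cdiffx h z i + cdiffx h (fun j => w j * z j) i).

(* u^{k+1/2} *)
Definition uhalf {R : realType} (u : nat -> int -> R) (k : nat) (i : int) : R :=
  (u k i + u k.+1 i) / 2.

(* The average of u^{k-1} and u^{k+1}; used only for 1 <= k. *)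
Definition ubar {R : realType} (u : nat -> int -> R) (k : nat) (i : int) : R :=
  (u k.-1 i + u k.+1 i) / 2.

(* delta_t u^{k+1/2} *)
Definition deltat {R : realType} (tau : R) (u : nat -> int -> R) (k : nat)
    (i : int) : R :=
  (u k.+1 i - u k i) / tau.

(* The centred difference Delta_t u^k; used only for 1 <= k. *)
Definition cdifft {R : realType} (tau : R) (u : nat -> int -> R) (k : nat)
    (i : int) : R :=
  (u k.+1 i - u k.-1 i) / (2 * tau).

Definition seminorm1 {R : realType} (M : nat) (h : R) (w : int -> R) : R :=
  Num.sqrt (h * \sum_(1 <= i < M.+1) deltax h w (i%:Z - 1) ^+ 2).

(* Left-hand side of the first-step equation. *)
Definition first_lhs {R : realType} (mu gamma kappa nu h tau : R)
    (u v : nat -> int -> R) (i : int) : R :=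
  deltat tau u 0 i - mu * deltat tau v 0 i
  + gamma * (psi h (u 0%N) (uhalf u 0) i
             - h ^+ 2 / 2 * psi h (v 0%N) (uhalf u 0) i)
  + kappa * (cdiffx h (uhalf u 0) i - h ^+ 2 / 6 * cdiffx h (uhalf v 0) i)
  - nu * uhalf v 0 i.

(* Left-hand side of the three-level equation. *)
Definition main_lhs {R : realType} (mu gamma kappa nu h tau : R)
    (u v : nat -> int -> R) (k : nat) (i : int) : R :=
  cdifft tau u k i - mu * cdifft tau v k i
  + gamma * (psi h (u k) (ubar u k) i - h ^+ 2 / 2 * psi h (v k) (ubar u k) i)
  + kappa * (cdiffx h (ubar u k) i - h ^+ 2 / 6 * cdiffx h (ubar v k) i)
  - nu * ubar v k i.

Definition compact_rhs {R : realType} (h : R) (u v : nat -> int -> R) (k : nat)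
    (i : int) : R :=
  deltax2 h (u k) i - h ^+ 2 / 12 * deltax2 h (v k) i.

Record is_scheme_solution {R : realType} (mu gamma kappa nu : R) (M N : nat)
    (h tau : R) (phi : R -> R) (u v : nat -> int -> R) : Prop := {
  scheme_periodic_u : forall k : nat, (k <= N)%N -> grid_periodic M (u k);
  scheme_periodic_v : forall k : nat, (k <= N)%N -> grid_periodic M (v k);
  scheme_initial : forall i : int, u 0%N i = phi (i%:~R * h);
  scheme_first : forall i : nat, (1 <= i <= M)%N ->
    first_lhs mu gamma kappa nu h tau u v i%:Z = 0;
  scheme_main : forall k i : nat, (1 <= k < N)%N -> (1 <= i <= M)%N ->
    main_lhs mu gamma kappa nu h tau u v k i%:Z = 0;
  scheme_compact : forall k i : nat, (k <= N)%N -> (1 <= i <= M)%N ->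
    v k i%:Z = compact_rhs h u v k i%:Z }.

(* U_i^k = u(x_i, t_k) and V_i^k = u_xx(x_i, t_k). *)
Definition gridU {R : realType} (h tau : R) (u : R -> R -> R) (k : nat)
    (i : int) : R :=
  u (i%:~R * h) (k%:R * tau).

Definition gridV {R : realType} (h tau : R) (u : R -> R -> R) (k : nat)
    (i : int) : R :=
  dx 2 u (i%:~R * h) (k%:R * tau).

(* The exact values satisfy the difference equations with perturbations Q^0,
   Q^k, R^k added to the right-hand sides, bounded by c1 (tau + h^4),
   c2 (tau^2 + h^4), c3 h^4 on every grid (here P is the perturbation written
   R^k in the third equation). *)
Definition is_consistent {R : realType} (L T mu gamma kappa nu : R)
    (u : R -> R -> R) (c1 c2 c3 : R) : Prop :=
  forall M N : nat, (0 < M)%N -> (0 < N)%N ->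
  let h := L / M%:R in
  let tau := T / N%:R in
  let U := gridU h tau u in
  let V := gridV h tau u in
  exists (Q P : nat -> int -> R),
  [/\ forall i : nat, (1 <= i <= M)%N ->
        first_lhs mu gamma kappa nu h tau U V i%:Z = Q 0%N i%:Z /\
        `|Q 0%N i%:Z| <= c1 * (tau + h ^+ 4),
      forall k i : nat, (1 <= k < N)%N -> (1 <= i <= M)%N ->
        main_lhs mu gamma kappa nu h tau U V k i%:Z = Q k i%:Z /\
        `|Q k i%:Z| <= c2 * (tau ^+ 2 + h ^+ 4) &
      forall k i : nat, (k <= N)%N -> (1 <= i <= M)%N ->
        V k i%:Z = compact_rhs h U V k i%:Z + P k i%:Z /\
        `|P k i%:Z| <= c3 * h ^+ 4].

Definition c5 {R : realType} (L mu gamma kappa nu c0 c1 c3 h0 tau0 : R) : R :=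
  (27 / 4 * (nu * tau0 / 2 - mu) ^+ 2
   + 3 * kappa ^+ 2 * h0 ^+ 2 * tau0 ^+ 2 / 16
   + 3 * gamma ^+ 2 * c0 ^+ 2 * tau0 ^+ 2 * h0 ^+ 2 * (h0 + 1) ^+ 2 / 4
   + mu * h0 ^+ 2 / 16
   + nu * h0 ^+ 2 * tau0 / 32
   + 3 / 2 * (mu + nu * tau0 / 2) ^+ 2
   + kappa ^+ 2 * h0 ^+ 4 * tau0 ^+ 2 / (576 * mu)
   + kappa ^+ 2 * h0 ^+ 2 * tau0 ^+ 2 / 24) * L * c3 ^+ 2
  + 3 * L * c1 ^+ 2 / 2.

Definition c6 {R : realType} (L gamma kappa c0 c3 h0 : R) : R :=
  5 * gamma ^+ 2 * (L * c0 + Num.sqrt L) ^+ 2 / 8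
  + 5 * gamma ^+ 2 / 8
    * (L * c0 * h0 ^+ 2 / 2
       + 3 * Num.sqrt L / 2
         * Num.sqrt (8 + 2 * L * c3 ^+ 2 * h0 ^+ 10)) ^+ 2
  + 5 * kappa ^+ 2 / 2
  + 10 * kappa ^+ 2 / 9
  + 5 * gamma ^+ 2 * (L * c0 + c0) ^+ 2 / 18.

Definition c7 {R : realType} (mu gamma kappa nu c0 h0 : R) : R :=
  5 * gamma ^+ 2 * (h0 * c0 + c0) ^+ 2
  + 3 * kappa ^+ 2 * h0 ^+ 2 / (16 * mu)
  + kappa ^+ 2 * h0 ^+ 2 / (48 * mu)
  + kappa ^+ 2 * h0 ^+ 4 / 72
  + nu ^+ 2 * h0 ^+ 2 / 8.

Definition c8 {R : realType} (L mu kappa nu c2 c3 h0 : R) : R :=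
  (3 * mu * h0 ^+ 2 / 32
   + 5 * mu ^+ 2 / 2
   + 1 / 2
   + 5 * kappa ^+ 2 * h0 ^+ 2 / 18
   + 5 * nu ^+ 2 / 2) * L * c3 ^+ 2
  + 5 * L * c2 ^+ 2 / 2.

Definition c9 {R : realType} (L mu gamma kappa nu c0 c2 c3 h0 : R) : R :=
  Num.max (c6 L gamma kappa c0 c3 h0)
    (Num.max (c7 mu gamma kappa nu c0 h0) (c8 L mu kappa nu c2 c3 h0)).

Definition c10 {R : realType} (L T mu gamma kappa nu c0 c1 c2 c3 h0 tau0 : R) :
    R :=
  expR (6 * T * c9 L mu gamma kappa nu c0 c2 c3 h0 / nu)
  * (5 * c5 L mu gamma kappa nu c0 c1 c3 h0 tau0 / (4 * mu)
     + 3 * h0 ^+ 2 * L * c3 ^+ 2 / 8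
     + 1 / 2).

Definition c4 {R : realType} (L T mu gamma kappa nu c0 c1 c2 c3 h0 tau0 : R) :
    R :=
  Num.max (Num.sqrt (c5 L mu gamma kappa nu c0 c1 c3 h0 tau0 / mu))
    (Num.sqrt (2 * c10 L T mu gamma kappa nu c0 c1 c2 c3 h0 tau0)).

(* Main.v *)
Require Import Defs.
From HB Require Import structures.
From mathcomp Require Import all_boot all_order all_algebra.
From mathcomp Require Import all_classical all_reals all_analysis.
From mathcomp Require Import zify ring lra.
Set Implicit Arguments.
Unset Strict Implicit.
Unset Printing Implicit Defensive.
Import Order.TTheory GRing.Theory Num.Theory.
Import numFieldNormedType.Exports.
Local Open Scope classical_set_scope.
Local Open Scope ring_scope.

(* Since nu != 0, c5 grows like tau0^2, so h0 = 1 and a large tau0 make c4 as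
   large as desired: it suffices to bound the error by C (tau^2 + h^4) whenever
   tau^2 + h^4 <= 1/C, for some C depending only on the data.
   This is done in the sup norm. Put w = e - mu f. The compact relation turns
   into e - (mu - h^2/12) delta_x^2 e = (1 + h^2/12 delta_x^2) w + mu R, so by the
   maximum principle e, f and delta_x e are bounded by |w| + mu |R|. The scheme
   expresses the time difference of w alone, by terms that are Lipschitz in e, f
   and delta_x e as long as the error at the middle level is at most 1; no time
   difference of R occurs. A discrete Gronwall induction concludes; the
   condition tau^2 + h^4 <= 1/C keeps the errors below 1. *)

(** * Periodic grid functions and the discrete maximum principle *)

Section PeriodicGrid.
Variables (R : realType) (M : nat).
Hypothesis M_gt0 : (0 < M)%N.
Implicit Types (w g : int -> R) (a B : R).

Lemma grid_periodicMn w : grid_periodic M w ->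
  forall (n : nat) (i : int), w (i + (n * M)%N%:Z) = w i.
Proof.
move=> per; elim=> [|n IHn] i; first by rewrite mul0n addr0.
by rewrite mulSn addnC PoszD addrA per IHn.
Qed.

(** Dividing [i - 1] instead of [i] by [M] puts the representative in the range 1..M used by the
    scheme. The sign of the quotient decides which of the two indices is reached from the other by
    adding a natural multiple of [M]. *)
Lemma grid_periodic_repr w : grid_periodic M w ->
  forall i : int, exists2 j : nat, (1 <= j <= M)%N & w i = w j%:Z.
Proof.
move=> per i; have eqi := divz_eq (i - 1) M.
have r_ge0 : 0 <= ((i - 1) %% M)%Z by rewrite modz_ge0 //; lia.
have r_ltM : ((i - 1) %% M)%Z < M by rewrite ltz_pmod //; lia.
move: (X in _ = X * _ + _) eqi r_ge0 r_ltM => q; move: (_ %% _)%Z => r.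
case: r => // r; case: q => q eqi _ rM; exists r.+1; try lia.
  rewrite -(grid_periodicMn per q r.+1); congr (w _).
  by move: eqi; rewrite PoszM => eqi; lia.
rewrite -(grid_periodicMn per q.+1 i); congr (w _).
by move: eqi; rewrite PoszM NegzE mulNr => eqi; lia.
Qed.

(** The scheme and the consistency bounds speak of one period only; this carries them to all
    integers, where shifted indices cause no trouble. *)
Lemma grid_periodic_bound w B : grid_periodic M w ->
  (forall j : nat, (1 <= j <= M)%N -> `|w j%:Z| <= B) ->
  forall i, `|w i| <= B.
Proof. by move=> per wB i; have [j jM ->] := grid_periodic_repr per i; exact: wB. Qed.

Lemma grid_periodic_argmax w : grid_periodic M w ->
  exists j, forall i, `|w i| <= `|w j|.
Proof.
move=> per.
have [j _ jmax] := @arg_maxP _ _ _ (Ordinal M_gt0) xpredT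
  (fun j : 'I_M => `|w j.+1%:Z|) isT.
exists j.+1%:Z; apply: grid_periodic_bound => // -[//|k] /= kM.
exact: (jmax (Ordinal kM)).
Qed.

(** At a point j where |w| is largest, [(1 + 2 * a) * w j] equals [g j] plus [a] times the two
    neighbours. These contribute at most [2 * a * |w j|], which cancels and leaves |w j| <= |g
    j|. *)
Lemma grid_max_principle w g a B : grid_periodic M w -> 0 <= a ->
  (forall i, w i - a * (w (i + 1) - 2 * w i + w (i - 1)) = g i) ->
  (forall i, `|g i| <= B) -> forall i, `|w i| <= B.
Proof.
move=> per a0 eqg gB i; have [j jmax] := grid_periodic_argmax per.
apply: le_trans (jmax i) _; move: (gB j) (jmax (j + 1)) (jmax (j - 1)).
have e : (1 + 2 * a) * w j = g j + a * w (j + 1) + a * w (j - 1).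
  by rewrite -eqg; ring.
have : `|(1 + 2 * a) * w j| <= `|g j| + a * `|w (j + 1)| + a * `|w (j - 1)|.
  rewrite e; apply: le_trans (ler_normD _ _) _; rewrite normrM (ger0_norm a0).
  by rewrite lerD2r; apply: le_trans (ler_normD _ _) _; rewrite normrM (ger0_norm a0).
rewrite normrM ger0_norm; last by lra.
nra.
Qed.

End PeriodicGrid.

(** * Sup-norm estimates derived from the compact relation *)

Section DifferenceBounds.
Variables (R : realType) (M : nat) (h : R).
Hypotheses (M_gt0 : (0 < M)%N) (h_gt0 : 0 < h).
Implicit Types (w e f : int -> R) (C D W mu rho : R).

Lemma deltaxB w i : deltax h w i - deltax h w (i - 1) = h * deltax2 h w i.
Proof. by rewrite /deltax /deltax2 subrK; field; rewrite gt_eqF. Qed.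

Lemma sum_deltax w i n :
  \sum_(0 <= k < n) deltax h w (i + k%:Z) = (w (i + n%:Z) - w i) / h.
Proof.
elim: n => [|n IHn]; first by rewrite big_nil addr0 subrr mul0r.
rewrite big_nat_recr //= IHn /deltax.
have -> : i + n.+1%:Z = i + n%:Z + 1 by lia.
ring.
Qed.

(* The differences of a periodic function sum to zero over a period, so they
   are controlled by their own oscillation. *)
Lemma deltax_bound w D : grid_periodic M w ->
  (forall i, `|deltax2 h w i| <= D) ->
  forall i, `|deltax h w i| <= h * M%:R * D.
Proof.
move=> per wD i; set d := deltax h w.
have D0 : 0 <= D by apply: le_trans (wD 0).
have osc (k : nat) : `|d (i + k%:Z) - d i| <= k%:R * (h * D).
  elim: k => [|k IHk]; first by rewrite addr0 subrr normr0 mul0r.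
  have -> : d (i + k.+1%:Z) - d i
      = h * deltax2 h w (i + k.+1%:Z) + (d (i + k%:Z) - d i).
    rewrite -deltaxB -/d.
    have -> : i + k.+1%:Z - 1 = i + k%:Z by lia.
    ring.
  apply: le_trans (ler_normD _ _) _; rewrite normrM (gtr0_norm h_gt0).
  rewrite -natr1 mulrDl mul1r addrC lerD //.
  by rewrite ler_pM2l.
have sum0 : \sum_(0 <= k < M) d (i + k%:Z) = 0.
  by rewrite sum_deltax per subrr mul0r.
(* Since [d] sums to zero over a period, the sum on the left is [- M * d i]. *)
have : `|\sum_(0 <= k < M) (d (i + k%:Z) - d i)| <= M%:R * (M%:R * (h * D)).
  apply: le_trans (ler_norm_sum _ _ _) _.
  apply: (@le_trans _ _ (\sum_(0 <= k < M) M%:R * (h * D))).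
    rewrite big_nat [leRHS]big_nat; apply: ler_sum => k /andP[_ kM].
    apply: le_trans (osc k) _; apply: ler_wpM2r.
      by rewrite mulr_ge0 // ltW.
    by rewrite ler_nat ltnW.
  by rewrite sumr_const_nat subn0 -[leLHS]mulr_natl.
rewrite sumrB sum0 sub0r normrN sumr_const_nat subn0 normrMn -[leLHS]mulr_natl.
by rewrite ler_pM2l ?ltr0n // mulrCA mulrA.
Qed.


(* [1 + h^2/12 delta_x^2] averages with weights 1/12, 10/12, 1/12, hence is a
   contraction in the sup norm. *)
Lemma compact_bound e f rho C : grid_periodic M e -> grid_periodic M f ->
  (forall i, `|f i - (deltax2 h e i - h ^+ 2 / 12 * deltax2 h f i)| <= rho) ->
  (forall i, `|f i| <= C) -> forall i, `|deltax2 h e i| <= C + rho.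
Proof.
move=> pe pf res fC i.
have -> : deltax2 h e i = 10 / 12 * f i + (f (i + 1) + f (i - 1)) / 12
   - (f i - (deltax2 h e i - h ^+ 2 / 12 * deltax2 h f i)).
  have -> : h ^+ 2 / 12 * deltax2 h f i = (f (i + 1) - 2 * f i + f (i - 1)) / 12.
    by rewrite /deltax2; field; rewrite gt_eqF.
  lra.
move: (res i) (fC i) (fC (i + 1)) (fC (i - 1)); rewrite !ler_norml.
move: (_ - _ * deltax2 h f i) (f i) (f (i + 1)) (f (i - 1)) => a b c d.
lra.
Qed.

(** Eliminating f = (e - w) / mu from the compact relation gives an elliptic equation for e, whose
    coefficient [mu / h ^+ 2 - 1 / 12] is nonnegative because [h ^+ 2 <= 6 * mu]; the maximum
    principle bounds e. Then mu f = e - w bounds f, and the compact relation bounds the second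
    difference of e, hence its first difference. *)
Lemma elliptic_bound mu e f rho W : 0 < mu -> h ^+ 2 <= 6 * mu ->
  grid_periodic M e -> grid_periodic M f ->
  (forall i, `|f i - (deltax2 h e i - h ^+ 2 / 12 * deltax2 h f i)| <= rho) ->
  (forall i, `|e i - mu * f i| <= W) ->
  [/\ forall i, `|e i| <= W + mu * rho,
      forall i, `|f i| <= 2 / mu * (W + mu * rho) &
      forall i, `|deltax h e i| <= h * M%:R * (3 / mu * (W + mu * rho))].
Proof.
move=> mu0 hmu pe pf res wW.
have rho0 : 0 <= rho by apply: le_trans (res 0).
have W0 : 0 <= W by apply: le_trans (wW 0).
have eE i : `|e i| <= W + mu * rho.
  have h2 : 0 < h ^+ 2 by rewrite exprn_gt0.
  apply: (@grid_max_principle _ _ M_gt0 e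
    (fun i => 10 / 12 * (e i - mu * f i)
       + ((e (i + 1) - mu * f (i + 1)) + (e (i - 1) - mu * f (i - 1))) / 12
       + mu * (f i - (deltax2 h e i - h ^+ 2 / 12 * deltax2 h f i)))
    (mu / h ^+ 2 - 1 / 12)) => // [|j|j].
  - rewrite subr_ge0 ler_pdivlMr //; lra.
  - by rewrite /deltax2; field; rewrite gt_eqF.
  - have := wW j; have := wW (j + 1); have := wW (j - 1).
    have : `|mu * (f j - (deltax2 h e j - h ^+ 2 / 12 * deltax2 h f j))| <= mu * rho.
      by rewrite normrM gtr0_norm // ler_pM2l.
    rewrite !ler_norml.
    move: (mu * (_ - _)) (e j - _) (e (j + 1) - _) (e (j - 1) - _) (mu * rho).
    move=> a b c d r; lra.
have fE i : `|f i| <= 2 / mu * (W + mu * rho).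
  rewrite mulrAC ler_pdivlMr // -[mu in leLHS]gtr0_norm // -normrM.
  have mr0 : 0 <= mu * rho by rewrite mulr_ge0 // ltW.
  move: (wW i) (eE i); rewrite (mulrC (f i)) !ler_norml.
  move: (mu * f i) (mu * rho) mr0 => a b; lra.
split=> // i; apply: deltax_bound => // j.
apply: le_trans (compact_bound pe pf res fE j) _.
have : rho <= (W + mu * rho) / mu by rewrite ler_pdivlMr //; lra.
lra.
Qed.

(** This is the compact relation for e = 0, the situation at time 0. At a maximum of |f| the central
    weight 10/12 exceeds the neighbours' total weight 2/12 by 2/3, whence the factor 3/2. *)
Lemma compact_eq0_bound f rho : grid_periodic M f ->
  (forall i, `|f i + h ^+ 2 / 12 * deltax2 h f i| <= rho) ->
  forall i, `|f i| <= 3 / 2 * rho.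
Proof.
move=> per res i; have [j jmax] := grid_periodic_argmax M_gt0 per.
apply: le_trans (jmax i) _; move: (res j) (jmax (j + 1)) (jmax (j - 1)).
have -> : f j + h ^+ 2 / 12 * deltax2 h f j
    = 10 / 12 * f j + (f (j + 1) + f (j - 1)) / 12.
  by rewrite /deltax2; field; rewrite gt_eqF.
move: (f j) (f (j + 1)) (f (j - 1)) => a b c.
by rewrite !ler_norml; case: (ler0P a) => ?; lra.
Qed.

End DifferenceBounds.

(** * The spatial operator and its Lipschitz bounds *)

(** Shared by both time-stepping equations: [a], [b] stand for u, v at the known level, [y], [z] for
    their time averages. *)
Definition spatial {R : realType} (gamma kappa nu h : R)
    (a b y z : int -> R) (i : int) : R :=
  gamma * (psi h a y i - h ^+ 2 / 2 * psi h b y i)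
  + kappa * (cdiffx h y i - h ^+ 2 / 6 * cdiffx h z i) - nu * z i.

(** A discrete Lipschitz norm, in which [psi] is bounded uniformly in [h]. *)
Definition bounded1 {R : realType} (h : R) (w : int -> R) (p : R) : Prop :=
  forall i, `|w i| <= p /\ `|deltax h w i| <= p.

Section SpatialOperator.
Variables (R : realType) (h : R).
Hypotheses (h_gt0 : 0 < h) (h_le1 : h <= 1).
Implicit Types (w z : int -> R) (p q B : R).

Lemma ler_normM (x y p q : R) : `|x| <= p -> `|y| <= q -> `|x * y| <= p * q.
Proof. by move=> xp yq; rewrite normrM ler_pM. Qed.

Lemma cdiffx_bound w p i : bounded1 h w p -> `|cdiffx h w i| <= p.
Proof.
move=> wp; have -> : cdiffx h w i = (deltax h w i + deltax h w (i - 1)) / 2.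
  by rewrite /cdiffx /deltax subrK; field; rewrite gt_eqF.
have [_] := wp i; have [_] := wp (i - 1); rewrite !ler_norml.
move: (deltax h w i) (deltax h w (i - 1)) => a b; lra.
Qed.

(** Differences of v occur in the scheme only with a factor [h ^+ 2]. One factor [h] pays for the
    difference, so sup bounds on v and its error suffice. *)
Lemma hcdiffx_bound w p i : (forall j, `|w j| <= p) -> `|h * cdiffx h w i| <= p.
Proof.
move=> wp; have -> : h * cdiffx h w i = (w (i + 1) - w (i - 1)) / 2.
  by rewrite /cdiffx; field; rewrite gt_eqF.
have := wp (i + 1); have := wp (i - 1); rewrite !ler_norml.
move: (w (i + 1)) (w (i - 1)) => a b; lra.
Qed.

(** The discrete product rule splits the difference of [w z] so that [psi] becomes the mean of three
    products, each at most [p * q]. *)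
Lemma psi_bound w z p q i : bounded1 h w p -> bounded1 h z q ->
  `|psi h w z i| <= p * q.
Proof.
move=> wp zq.
have -> : psi h w z i = (w i * cdiffx h z i + w (i + 1) * cdiffx h z i
    + cdiffx h w i * z (i - 1)) / 3.
  by rewrite /psi /cdiffx; field; rewrite gt_eqF.
have := ler_normM (wp i).1 (cdiffx_bound i zq).
have := ler_normM (wp (i + 1)).1 (cdiffx_bound i zq).
have := ler_normM (cdiffx_bound i wp) (zq (i - 1)).1.
rewrite !ler_norml; move: (_ * z _) (w i * _) (w (i + 1) * _) (p * q).
move=> a b c d; lra.
Qed.

Lemma hpsi_bound w z p q i : (forall j, `|w j| <= p) -> bounded1 h z q ->
  `|h * psi h w z i| <= p * q.
Proof.
move=> wp zq.
have -> : h * psi h w z i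
    = (w i * (h * cdiffx h z i) + h * cdiffx h (fun j => w j * z j) i) / 3.
  by rewrite /psi; ring.
have := ler_normM (wp i) (hcdiffx_bound i (fun j => (zq j).1)).
have := hcdiffx_bound i (fun j => ler_normM (wp j) (zq j).1).
rewrite !ler_norml; move: (_ * cdiffx h (fun j => _) i) (w i * _) (p * q).
move=> a b d; lra.
Qed.

(* [a - a'] is written as the error of [a], and so on: the bilinear form [psi]
   produces one term that is quadratic in the errors, harmless since [p <= 1]. *)
Lemma spatial_lipschitz gamma kappa nu (a b y z a' b' y' z' : int -> R) p q B i :
  bounded1 h a B -> (forall i, `|b i| <= B) -> bounded1 h y B ->
  bounded1 h (fun i => a i - a' i) p -> (forall i, `|b i - b' i| <= p) ->
  bounded1 h (fun i => y i - y' i) q -> (forall i, `|z i - z' i| <= q) ->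
  p <= 1 ->
  `|spatial gamma kappa nu h a b y z i - spatial gamma kappa nu h a' b' y' z' i|
   <= (2 * `|gamma| * (B + 1) + 2 * `|kappa| + `|nu|) * (p + q).
Proof.
move=> aB bB yB ap bp yq zq p1.
have p0 : 0 <= p by apply: le_trans (bp 0).
have q0 : 0 <= q by apply: le_trans (zq 0).
have B0 : 0 <= B by apply: le_trans (bB 0).
set ey := fun i => y i - y' i; set ez := fun i => z i - z' i.
have Kpsi (x s t r : R) : `|x| <= p * B -> `|s| <= B * q -> `|t| <= p * q ->
    r = x + s - t -> `|r| <= (B + 1) * (p + q).
  have pq : p * q <= q by rewrite ler_piMl.
  have pB : 0 <= p * B by rewrite mulr_ge0.
  rewrite !ler_norml => + + + ->; lra.
have g1 : `|psi h a y i - psi h a' y' i| <= (B + 1) * (p + q).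
  apply: Kpsi (psi_bound i ap yB) (psi_bound i aB yq) (psi_bound i ap yq) _.
  by rewrite /psi /cdiffx; ring.
have g2 : `|h * psi h b y i - h * psi h b' y' i| <= (B + 1) * (p + q).
  apply: Kpsi (hpsi_bound i bp yB) (hpsi_bound i bB yq) (hpsi_bound i bp yq) _.
  by rewrite /psi /cdiffx; ring.
have k1 := cdiffx_bound i yq; have k2 := hcdiffx_bound i zq.
have -> : spatial gamma kappa nu h a b y z i - spatial gamma kappa nu h a' b' y' z' i
  = gamma * ((psi h a y i - psi h a' y' i)
       - h / 2 * (h * psi h b y i - h * psi h b' y' i))
    + kappa * (cdiffx h ey i - h / 6 * (h * cdiffx h ez i)) - nu * (z i - z' i).
  by rewrite /spatial /ey /ez /cdiffx; ring.
have t1 : `|gamma * ((psi h a y i - psi h a' y' i)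
       - h / 2 * (h * psi h b y i - h * psi h b' y' i))|
    <= `|gamma| * (2 * ((B + 1) * (p + q))).
  apply: ler_normM => //; apply: le_trans (ler_normB _ _) _.
  rewrite [X in _ + X]normrM [`|h / 2|]ger0_norm; last by rewrite divr_ge0 // ltW.
  have : h / 2 * `|h * psi h b y i - h * psi h b' y' i| <= 1 * ((B + 1) * (p + q)).
    by apply: ler_pM => //; move: h_gt0 h_le1; lra.
  by lra.
have t2 : `|kappa * (cdiffx h ey i - h / 6 * (h * cdiffx h ez i))|
    <= `|kappa| * (2 * (p + q)).
  apply: ler_normM => //; apply: le_trans (ler_normB _ _) _.
  rewrite [X in _ + X]normrM [`|h / 6|]ger0_norm; last by rewrite divr_ge0 // ltW.
  have : h / 6 * `|h * cdiffx h ez i| <= 1 * q.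
    by apply: ler_pM => //; move: h_gt0 h_le1; lra.
  by move: k1; rewrite -/ey; lra.
have t3 : `|nu * (z i - z' i)| <= `|nu| * (p + q).
  by apply: ler_normM => //; apply: le_trans (zq i) _; lra.
apply: le_trans (ler_normB _ _) _; apply: le_trans (lerD (ler_normD _ _) t3) _.
apply: le_trans (lerD (lerD t1 t2) (lexx _)) _.
by rewrite le_eqVlt; apply/orP; left; apply/eqP; ring.
Qed.

End SpatialOperator.

(** * Propagation of the error over one time step *)

Record compatible_error {R : realType} (M : nat) (h rho : R) (e f : int -> R) :
    Prop := {
  compatible_periodic_u : grid_periodic M e;
  compatible_periodic_v : grid_periodic M f;
  compatible_residual : forall i,
    `|f i - (deltax2 h e i - h ^+ 2 / 12 * deltax2 h f i)| <= rho }.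

(** The sum of the three constants of [elliptic_bound] when [h * M = L], so that one constant serves
    e, f and the difference of e. *)
Definition elliptic_const {R : realType} (L mu : R) : R :=
  1 + 2 / mu + 3 * L / mu.

Definition lipschitz_const {R : realType} (gamma kappa nu B : R) : R :=
  2 * `|gamma| * (B + 1) + 2 * `|kappa| + `|nu|.

Lemma elliptic_const_gt0 {R : realType} (L mu : R) :
  0 <= L -> 0 < mu -> 0 < elliptic_const L mu.
Proof.
move=> L0 mu0.
have : 0 <= 3 * L / mu by rewrite divr_ge0 ?mulr_ge0 // ltW.
have : 0 <= 2 / mu by rewrite divr_ge0 // ltW.
by rewrite /elliptic_const; lra.
Qed.

Lemma lipschitz_const_ge0 {R : realType} (gamma kappa nu B : R) :
  0 <= B -> 0 <= lipschitz_const gamma kappa nu B.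
Proof.
by move=> B0; rewrite !addr_ge0 // !mulr_ge0 // addr_ge0.
Qed.

Section Step.
Variables (R : realType) (L mu gamma kappa nu B h rho : R) (M : nat).
Hypotheses (M_gt0 : (0 < M)%N) (h_gt0 : 0 < h) (h_le1 : h <= 1)
  (hM : h * M%:R = L) (mu_gt0 : 0 < mu) (hmu : h ^+ 2 <= 6 * mu).

Let K1 := elliptic_const L mu.
Let K := lipschitz_const gamma kappa nu B.

(** Counting [mu * rho] in the size of the error lets the single number [E] control everything, and
    the induction in time needs no separate residual term. *)
Lemma compatible_error_bound e f (E : R) : compatible_error M h rho e f ->
  (forall i, `|e i - mu * f i| + mu * rho <= E) ->
  bounded1 h e (K1 * E) /\ forall i, `|f i| <= K1 * E.
Proof.
move=> [pe pf res] wE.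
have L0 : 0 <= L by rewrite -hM mulr_ge0 // ltW.
have E0 : 0 <= E.
  apply: le_trans (wE 0); rewrite addr_ge0 // mulr_ge0 ?(ltW mu_gt0) //.
  exact: le_trans (res 0).
have wE' i : `|e i - mu * f i| <= E - mu * rho by rewrite lerBrDr.
have [] := elliptic_bound M_gt0 h_gt0 mu_gt0 hmu pe pf res wE'.
rewrite subrK hM => eE fE dE.
have K1E : K1 * E = E + 2 / mu * E + L * (3 / mu * E).
  by rewrite /K1 /elliptic_const; ring.
have t1 : 0 <= 2 / mu * E by rewrite mulr_ge0 ?divr_ge0 // ltW.
have t2 : 0 <= L * (3 / mu * E).
  by apply: mulr_ge0 => //; rewrite mulr_ge0 ?divr_ge0 // ltW.
split=> [i|i]; first split.
- by apply: le_trans (eE i) _; rewrite K1E; lra.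
- by apply: le_trans (dE i) _; rewrite K1E; lra.
- by apply: le_trans (fE i) _; rewrite K1E; lra.
Qed.

Lemma bounded1_mean w z p q : bounded1 h w p -> bounded1 h z q ->
  bounded1 h (fun i => (w i + z i) / 2) ((p + q) / 2).
Proof.
move=> wp zq i; have [w0 w1] := wp i; have [z0 z1] := zq i.
have -> : deltax h (fun i => (w i + z i) / 2) i = (deltax h w i + deltax h z i) / 2.
  by rewrite /deltax; ring.
move: w0 w1 z0 z1; rewrite !ler_norml.
by move: (deltax h w i) (deltax h z i) => a b; split; lra.
Qed.

(* With w = e - mu f, the scheme reads w^+ = w^- + s (residual - spatial error);
   [s] is tau in the first step and 2 tau later. The part of the spatial error
   that depends on w^+ is absorbed because s (K K1) <= 1. *)
Lemma error_step (s q Y : R)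
    (Um Vm um vm U V u v Up Vp up vp : int -> R) :
  let Ub := fun i => (Um i + Up i) / 2 in
  let Vb := fun i => (Vm i + Vp i) / 2 in
  let ub := fun i => (um i + up i) / 2 in
  let vb := fun i => (vm i + vp i) / 2 in
  0 < s -> s * (K * K1) <= 1 -> K1 * Y <= 1 ->
  bounded1 h U B -> (forall i, `|V i| <= B) -> bounded1 h Ub B ->
  compatible_error M h rho (Um \- um) (Vm \- vm) ->
  compatible_error M h rho (U \- u) (V \- v) ->
  compatible_error M h rho (Up \- up) (Vp \- vp) ->
  (forall i, `|(Um i - um i) - mu * (Vm i - vm i)| + mu * rho <= Y) ->
  (forall i, `|(U i - u i) - mu * (V i - v i)| + mu * rho <= Y) ->
  (forall i, `|((Up i - Um i) / s - mu * ((Vp i - Vm i) / s)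
                  + spatial gamma kappa nu h U V Ub Vb i)
              - ((up i - um i) / s - mu * ((vp i - vm i) / s)
                  + spatial gamma kappa nu h u v ub vb i)| <= q) ->
  forall i, `|(Up i - up i) - mu * (Vp i - vp i)| + mu * rho
    <= (1 + 4 * (s * (K * K1))) * Y + 2 * (s * q).
Proof.
move=> Ub Vb ub vb s0 sK K1Y UB VB UbB cm c cp wm w eqn i.
set wp := fun i => (Up i - up i) - mu * (Vp i - vp i).
have pwp : grid_periodic M wp.
  move=> j; rewrite /wp; have := compatible_periodic_u cp j.
  by have := compatible_periodic_v cp j => /= -> ->.
(* The step is implicit: the spatial error at one point involves the new error at all points,
   through the elliptic bound. At a maximum point j of the new w, that bound is in terms of [E]
   itself, so the inequality closes. *)
have [j jmax] := grid_periodic_argmax M_gt0 pwp.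
set E := `|wp j| + mu * rho.
have wpE k : `|wp k| + mu * rho <= E by rewrite lerD2r.
have [em fm] := compatible_error_bound cm wm.
have [e f] := compatible_error_bound c w.
have [ep fp] := compatible_error_bound cp wpE.
apply: le_trans (wpE i) _.
have K1_gt0 : 0 < K1.
  by apply: elliptic_const_gt0 => //; rewrite -hM mulr_ge0 // ltW.
have B0 : 0 <= B by apply: le_trans (VB 0).
have K0 : 0 <= K by exact: lipschitz_const_ge0.
have q0 : 0 <= q by apply: le_trans (eqn 0).
have Y0 : 0 <= Y.
  apply: le_trans (w 0); rewrite addr_ge0 // mulr_ge0 ?(ltW mu_gt0) //.
  exact: le_trans (compatible_residual c 0).
have eb : bounded1 h (fun i => Ub i - ub i) ((K1 * Y + K1 * E) / 2).
  have := bounded1_mean em ep.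
  have -> : (fun i => ((Um \- um) i + (Up \- up) i) / 2) = (fun i => Ub i - ub i).
    by apply/funext => k; rewrite /Ub /ub /=; ring.
  by [].
have fb k : `|Vb k - vb k| <= (K1 * Y + K1 * E) / 2.
  have -> : Vb k - vb k = ((Vm \- vm) k + (Vp \- vp) k) / 2.
    by rewrite /Vb /vb /=; ring.
  by move: (fm k) (fp k); rewrite !ler_norml; move: (_ k) ((_ \- _) k) => x y; lra.
have spat := spatial_lipschitz h_gt0 h_le1 gamma kappa nu j UB VB UbB e f eb fb K1Y.
rewrite -/(lipschitz_const gamma kappa nu B) -/K in spat.
have wj : `|wp j| <= `|(Um j - um j) - mu * (Vm j - vm j)|
    + s * (q + K * (K1 * Y + (K1 * Y + K1 * E) / 2)).
  have -> : wp j = ((Um j - um j) - mu * (Vm j - vm j))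
    + s * ((((Up j - Um j) / s - mu * ((Vp j - Vm j) / s)
                  + spatial gamma kappa nu h U V Ub Vb j)
              - ((up j - um j) / s - mu * ((vp j - vm j) / s)
                  + spatial gamma kappa nu h u v ub vb j))
      - (spatial gamma kappa nu h U V Ub Vb j - spatial gamma kappa nu h u v ub vb j)).
    by rewrite /wp; field; rewrite gt_eqF.
  apply: le_trans (ler_normD _ _) _; rewrite lerD2l normrM gtr0_norm //.
  rewrite ler_pM2l //; apply: le_trans (ler_normB _ _) _.
  exact: lerD (eqn j) spat.
have {wj} : E <= Y + s * q + s * (K * K1) * (Y + (Y + E) / 2).
  have := wm j; have -> : s * (K * K1) * (Y + (Y + E) / 2)
    = s * (K * (K1 * Y + (K1 * Y + K1 * E) / 2)) by ring.
  move: wj; rewrite mulrDr /E.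
  by move: `|wp j| => x; lra.
have : 0 <= s * (K * K1) by rewrite !mulr_ge0 // ltW.
have : 0 <= s * q by rewrite mulr_ge0 // ltW.
move: (s * q) (s * (K * K1)) sK => x y y1 x0 y0 EY.
have yY : 0 <= y * Y by rewrite mulr_ge0.
have yyY : y * (y * Y) <= y * Y by rewrite ler_piMl.
have yx : y * x <= x by rewrite ler_piMl.
(* Collecting [E] leaves (1 + 3y/2) Y + x on the right. For 0 <= y <= 1, (1 - y/2)(1 + 4y) >= 1 +
   3y/2 and 2(1 - y/2) >= 1, and the positive factor 1 - y/2 cancels. *)
have : (1 - y / 2) * E <= (1 - y / 2) * ((1 + 4 * y) * Y + 2 * x) by lra.
by rewrite ler_pM2l //; lra.
Qed.

End Step.

(** * Periodicity of derivatives, common form of the two equations, growth of [c4] *)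

Lemma derive1_shift {R : realType} (f : R -> R) (a : R) :
  (forall x, f (x + a) = f x) -> forall x, derive1 f (x + a) = derive1 f x.
Proof.
move=> per x; rewrite /derive1.
suff -> : (fun y => y^-1 *: (f (y + (x + a)) - f (x + a)))
    = (fun y => y^-1 *: (f (y + x) - f x)) by [].
by apply/funext => y; rewrite addrA !per.
Qed.

Lemma dx_periodic {R : realType} (L t : R) (u : R -> R -> R) n :
  (forall x, u (x + L) t = u x t) -> forall x, dx n u (x + L) t = dx n u x t.
Proof.
move=> per; elim: n => [//|n IHn]; exact: derive1_shift.
Qed.

Lemma first_lhsE {R : realType} (mu gamma kappa nu h tau : R)
    (u v : nat -> int -> R) i :
  first_lhs mu gamma kappa nu h tau u v i =
  (u 1%N i - u 0%N i) / tau - mu * ((v 1%N i - v 0%N i) / tau)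
  + spatial gamma kappa nu h (u 0%N) (v 0%N) (fun i => (u 0%N i + u 1%N i) / 2)
      (fun i => (v 0%N i + v 1%N i) / 2) i.
Proof. by rewrite /first_lhs /spatial /deltat /uhalf; ring. Qed.

(** Stated at [k.+1] so that the three levels appear without a predecessor. The shape is the one of
    [error_step] with s = 2 tau; the first equation fits it with s = tau and level 0 as both old and
    middle level. *)
Lemma main_lhsE {R : realType} (mu gamma kappa nu h tau : R)
    (u v : nat -> int -> R) k i :
  main_lhs mu gamma kappa nu h tau u v k.+1 i =
  (u k.+2 i - u k i) / (2 * tau) - mu * ((v k.+2 i - v k i) / (2 * tau))
  + spatial gamma kappa nu h (u k.+1) (v k.+1) (fun i => (u k i + u k.+2 i) / 2)
      (fun i => (v k i + v k.+2 i) / 2) i.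
Proof. by rewrite /main_lhs /spatial /cdifft /ubar /=; ring. Qed.

Lemma grid_periodic_deltax2 {R : realType} M (h : R) w :
  grid_periodic M w -> grid_periodic M (deltax2 h w).
Proof. by move=> per i; rewrite /deltax2 !(addrAC _ M%:Z) !per. Qed.

Lemma compact_residualB {R : realType} (h : R) (u v w z : nat -> int -> R) k i :
  (v k \- z k) i
    - (deltax2 h (u k \- w k) i - h ^+ 2 / 12 * deltax2 h (v k \- z k) i)
  = (v k i - compact_rhs h u v k i) - (z k i - compact_rhs h w z k i).
Proof. by rewrite /compact_rhs /deltax2 /=; ring. Qed.

Lemma grid_periodic_spatial {R : realType} M (gamma kappa nu h : R) a b y z :
  grid_periodic M a -> grid_periodic M b -> grid_periodic M y ->
  grid_periodic M z -> grid_periodic M (spatial gamma kappa nu h a b y z).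
Proof.
move=> pa pb py pz i; rewrite /spatial /psi /cdiffx.
by rewrite !(addrAC _ M%:Z) !pa !pb !py !pz.
Qed.

(* Only [c5] is used: the sign of [nu] is free, so [c10] may stay bounded. *)
Lemma c4_unbounded {R : realType} (L T mu gamma kappa nu c0 c1 c2 c3 C : R) :
  0 < L -> 0 < mu -> nu != 0 -> 0 < c3 -> 0 <= C ->
  exists2 tau0 : R, 0 < tau0 &
    C <= c4 L T mu gamma kappa nu c0 c1 c2 c3 1 tau0.
Proof.
move=> L0 mu0 nu0 c30 C0.
have D0 : 0 < L * c3 ^+ 2 by rewrite mulr_gt0 // exprn_gt0.
set m := mu / (L * c3 ^+ 2); have m0 : 0 < m by rewrite divr_gt0.
(* The target [c5 / mu >= C ^+ 2] amounts to a bracket in [c5] of at least [C ^+ 2 * m], and m <= (1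
   + m)^2 gives [C ^+ 2 * m <= s ^+ 2]. With [tau0] equal to 2 s / |nu|, the number nu tau0 / 2 is s
   or -s. *)
set s := 1 + C * (1 + m).
have s1 : 1 <= s by rewrite lerDl mulr_ge0 //; lra.
have nn0 : 0 < `|nu| by rewrite normr_gt0.
exists (2 * s / `|nu|); first by rewrite divr_gt0 // mulr_gt0 //; lra.
rewrite /c4 le_max; apply/orP; left.
rewrite -[C]ger0_norm // -sqrtr_sqr; apply: ler_wsqrtr.
rewrite ler_pdivlMr //; set tau0 := 2 * s / `|nu|.
have x2 : (nu * tau0 / 2) ^+ 2 = s ^+ 2.
  rewrite /tau0 {1}(numEsg nu).
  have -> : Num.sg nu * `|nu| * (2 * s / `|nu|) / 2 = Num.sg nu * s.
    by field; rewrite gt_eqF.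
  by rewrite exprMn sqr_sg nu0 mul1r.
have -> : C ^+ 2 * mu = C ^+ 2 * m * (L * c3 ^+ 2).
  by rewrite -mulrA /m mulfVK // gt_eqF.
rewrite /c5 -[X in _ <= X + _]mulrA.
apply: (@le_trans _ _ (s ^+ 2 * (L * c3 ^+ 2))).
  rewrite ler_pM2r //.
  have : C ^+ 2 * m <= (C * (1 + m)) ^+ 2.
    by rewrite exprMn ler_wpM2l ?sqr_ge0 //; nra.
  move/le_trans; apply; rewrite ler_sqr ?nnegrE; rewrite /s; nra.
rewrite -[leLHS]addr0 lerD //; last first.
  by rewrite divr_ge0 // mulr_ge0 ?sqr_ge0 // mulr_ge0 // ltW.
rewrite ler_pM2r //.
have t1 : 0 <= 3 * kappa ^+ 2 * 1 ^+ 2 * tau0 ^+ 2 / 16.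
  by rewrite ?expr1n ?(sqr_ge0, mulr_ge0, invr_ge0) // ltW.
have t2 : 0 <= 3 * gamma ^+ 2 * c0 ^+ 2 * tau0 ^+ 2 * 1 ^+ 2 * (1 + 1) ^+ 2 / 4.
  by rewrite ?expr1n ?(sqr_ge0, mulr_ge0, invr_ge0) // ltW.
have t3 : 0 <= kappa ^+ 2 * 1 ^+ 4 * tau0 ^+ 2 / (576 * mu).
  rewrite expr1n mulr1; apply: divr_ge0; first by rewrite mulr_ge0 ?sqr_ge0.
  exact: mulr_ge0 (ler0n _ _) (ltW mu0).
have t4 : 0 <= kappa ^+ 2 * 1 ^+ 2 * tau0 ^+ 2 / 24.
  by rewrite ?expr1n ?(sqr_ge0, mulr_ge0, invr_ge0) // ltW.
apply: (@le_trans _ _ (27 / 4 * (nu * tau0 / 2 - mu) ^+ 2 + mu * 1 ^+ 2 / 16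
   + nu * 1 ^+ 2 * tau0 / 32 + 3 / 2 * (mu + nu * tau0 / 2) ^+ 2)); last first.
  by move: t1 t2 t3 t4; lra.
(* With x = nu tau0 / 2 this is the only summand that can be negative. As x^2 >= 1, it is at least
   -x^2 / 16, which the two squares absorb. *)
have -> : nu * 1 ^+ 2 * tau0 / 32 = (nu * tau0 / 2) / 16 by field.
rewrite -x2; move: (nu * tau0 / 2) x2 => x x2.
have s2 : 1 <= x ^+ 2 by rewrite x2 exprn_ege1.
by rewrite expr1n mulr1; nra.
Qed.

Lemma seminorm1_bound {R : realType} M (h : R) w (p : R) : 0 < h ->
  (forall i, `|deltax h w i| <= p) ->
  seminorm1 M h w <= Num.sqrt (h * M%:R) * p.
Proof.
move=> h0 wp; have p0 : 0 <= p by apply: le_trans (wp 0).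
rewrite -[p in leRHS]ger0_norm // -sqrtr_sqr -sqrtrM ?mulr_ge0 ?(ltW h0) //.
apply: ler_wsqrtr; rewrite -mulrA ler_pM2l //.
apply: (@le_trans _ _ (\sum_(1 <= i < M.+1) p ^+ 2)); last first.
  by rewrite sumr_const_nat subn1 -[leLHS]mulr_natl.
apply: ler_sum => i _; rewrite -real_normK ?num_real //.
by rewrite ler_pXn2r ?nnegrE.
Qed.

(** * The error on a fixed grid *)

Section ConsistentGrid.
Variables (R : realType) (L T mu gamma kappa nu : R) (phi : R -> R)
  (u : R -> R -> R) (c0 c1 c2 c3 : R).
Hypotheses (L_gt0 : 0 < L) (T_gt0 : 0 < T) (mu_gt0 : 0 < mu)
  (c1_gt0 : 0 < c1) (c2_gt0 : 0 < c2) (c3_gt0 : 0 < c3)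
  (usol : is_bbmb_solution L T mu gamma kappa nu phi u)
  (c0max : is_derivative_max L T u c0)
  (ucons : is_consistent L T mu gamma kappa nu u c1 c2 c3).

Lemma derivative_max_ge0 : 0 <= c0.
Proof. by have [[n [x [t [_ _ _ ->]]]] _] := c0max. Qed.

Variables (M N : nat).
Hypotheses (M_gt0 : (0 < M)%N) (N_gt0 : (0 < N)%N).
Let h := L / M%:R.
Let tau := T / N%:R.
Let U := gridU h tau u.
Let V := gridV h tau u.

Let M0 : (0 : R) < M%:R. Proof. by rewrite ltr0n. Qed.
Let N0 : (0 : R) < N%:R. Proof. by rewrite ltr0n. Qed.
Let h_gt0 : 0 < h. Proof. by rewrite divr_gt0. Qed.
Let tau_gt0 : 0 < tau. Proof. by rewrite divr_gt0. Qed.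
Let hM : h * M%:R = L. Proof. by rewrite divfK // gt_eqF. Qed.

Lemma grid_time k : (k <= N)%N -> 0 <= k%:R * tau <= T.
Proof.
move=> kN; rewrite mulr_ge0 ?(ltW tau_gt0) //= /tau mulrA ler_pdivrMr //.
by rewrite mulrC ler_pM2l // ler_nat.
Qed.

Lemma gridV_periodic k : (k <= N)%N -> grid_periodic M (V k).
Proof.
move=> kN i; rewrite /V /gridV intrD mulrDl (mulrC M%:~R) -pmulrn hM.
by apply: dx_periodic => x; apply: (bbmb_periodic usol); exact: grid_time.
Qed.

Lemma gridU_periodic k : (k <= N)%N -> grid_periodic M (U k).
Proof.
move=> kN i; rewrite /U /gridU intrD mulrDl (mulrC M%:~R) -pmulrn hM.
by apply: (bbmb_periodic usol); exact: grid_time.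
Qed.

Lemma dx_grid_bound n k j : (n <= 3)%N -> (k <= N)%N -> (1 <= j <= M)%N ->
  `|dx n u (j%:Z%:~R * h) (k%:R * tau)| <= c0.
Proof.
move=> n3 kN /andP[_ jM]; apply: c0max.2.
exists n, (j%:Z%:~R * h), (k%:R * tau); split=> //; last exact: grid_time.
rewrite -pmulrn mulr_ge0 ?(ltW h_gt0) //= -hM mulrC ler_pM2l //.
by rewrite ler_nat.
Qed.

Lemma gridU_bound k : (k <= N)%N -> forall i, `|U k i| <= c0.
Proof.
move=> kN; apply: (grid_periodic_bound M_gt0 (gridU_periodic kN)) => j jM.
exact: (@dx_grid_bound 0).
Qed.

Lemma gridV_bound k : (k <= N)%N -> forall i, `|V k i| <= c0.
Proof.
move=> kN; apply: (grid_periodic_bound M_gt0 (gridV_periodic kN)) => j jM.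
exact: (@dx_grid_bound 2).
Qed.

Lemma compact_rhs_periodic w z k : grid_periodic M (w k) -> grid_periodic M (z k) ->
  grid_periodic M (compact_rhs h w z k).
Proof.
move=> pw pz i; rewrite /compact_rhs.
by rewrite (grid_periodic_deltax2 h pw) (grid_periodic_deltax2 h pz).
Qed.

Lemma grid_residual k : (k <= N)%N ->
  forall i, `|V k i - compact_rhs h U V k i| <= c3 * h ^+ 4.
Proof.
move=> kN; apply: (@grid_periodic_bound _ _ M_gt0 (fun i => V k i - _ i)) => [i|j jM].
  by rewrite (compact_rhs_periodic (gridU_periodic kN) (gridV_periodic kN))
    gridV_periodic.
have [Q [P [_ _ res]]] := ucons M_gt0 N_gt0.
have [eqV Pk] := res k j kN jM.
have -> : V k j%:Z = compact_rhs h U V k j%:Z + P k j%:Z := eqV.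
by rewrite addrC addKr.
Qed.

(** The compact relation bounds the second difference of [U] by [c0 + c3]; since first differences
    sum to zero over a period, they are at most [L * (c0 + c3)]. *)
Lemma gridU_bounded1 k : (k <= N)%N -> h <= 1 ->
  bounded1 h (U k) (c0 + L * (c0 + c3)).
Proof.
move=> kN h1 i; have c00 := derivative_max_ge0.
have LB : 0 <= L * (c0 + c3) by apply: mulr_ge0; [exact: ltW|by rewrite addr_ge0 // ltW].
split; first by apply: le_trans (gridU_bound kN i) _; lra.
have r3 : forall i, `|V k i - compact_rhs h U V k i| <= c3.
  move=> j; apply: le_trans (grid_residual kN j) _.
  by rewrite ler_piMr ?exprn_ile1 // ltW.
have := deltax_bound M_gt0 h_gt0 (gridU_periodic kN)
  (compact_bound h_gt0 (gridU_periodic kN) (gridV_periodic kN) r3 (gridV_bound kN)).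
by rewrite hM => /(_ i) /le_trans; apply; lra.
Qed.

Variables (uh vh : nat -> int -> R).
Hypothesis scheme : is_scheme_solution mu gamma kappa nu M N h tau phi uh vh.

Lemma grid_compatible_error k : (k <= N)%N ->
  compatible_error M h (c3 * h ^+ 4) (U k \- uh k) (V k \- vh k).
Proof.
move=> kN; have pU := gridU_periodic kN; have pV := gridV_periodic kN.
have pu := scheme_periodic_u scheme kN; have pv := scheme_periodic_v scheme kN.
have pe : grid_periodic M (U k \- uh k) by move=> i /=; rewrite pU pu.
have pf : grid_periodic M (V k \- vh k) by move=> i /=; rewrite pV pv.
split=> //.
apply: (@grid_periodic_bound _ _ M_gt0 (fun i => _ i - (_ i - _ * _ i))) => [i|j jM].
  by rewrite pf !(grid_periodic_deltax2 h) //.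
rewrite compact_residualB.
by rewrite -(scheme_compact scheme kN jM) subrr subr0; exact: grid_residual.
Qed.

Let err_le k Y := forall i,
  `|(U k i - uh k i) - mu * (V k i - vh k i)| + mu * (c3 * h ^+ 4) <= Y.

(** Initially e = 0, but f is only as small as the compact residual allows: 3/2 comes from
    [compact_eq0_bound] and 1 from the summand [mu * rho] in [err_le]. *)
Lemma grid_initial_error : err_le 0 (5 / 2 * (mu * (c3 * h ^+ 4))).
Proof.
have e0 i : U 0%N i - uh 0%N i = 0.
  by rewrite (scheme_initial scheme) /U /gridU mul0r (bbmb_initial usol) subrr.
have [pe pf res] := grid_compatible_error (leq0n N).
have f0 : forall i, `|(V 0%N \- vh 0%N) i| <= 3 / 2 * (c3 * h ^+ 4).
  apply: (compact_eq0_bound M_gt0 h_gt0 pf) => i.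
  have := res i; rewrite [deltax2 h (U 0%N \- _) i]/deltax2 /= !e0.
  by rewrite mulr0 subrr addr0 mul0r sub0r opprK.
move=> i; rewrite e0 sub0r normrN normrM gtr0_norm //.
have : mu * `|V 0%N i - vh 0%N i| <= mu * (3 / 2 * (c3 * h ^+ 4)).
  by rewrite ler_pM2l //; exact: f0.
by lra.
Qed.

Lemma first_residual i :
  `|first_lhs mu gamma kappa nu h tau U V i - first_lhs mu gamma kappa nu h tau uh vh i|
  <= c1 * (tau + h ^+ 4).
Proof.
move: i; apply: (@grid_periodic_bound _ _ M_gt0 (fun i => _ i - _ i)) => [i|j jM].
  have mean w : (forall k, (k <= 1)%N -> grid_periodic M (w k)) ->
      grid_periodic M (fun i => (w 0%N i + w 1%N i) / 2 : R).
    by move=> pw {}i; rewrite !pw.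
  have per w z : (forall k, (k <= 1)%N -> grid_periodic M (w k)) ->
      (forall k, (k <= 1)%N -> grid_periodic M (z k)) ->
      first_lhs mu gamma kappa nu h tau w z (i + M%:Z)
      = first_lhs mu gamma kappa nu h tau w z i.
    move=> pw pz; rewrite !first_lhsE.
    by rewrite (grid_periodic_spatial _ _ _ _ (pw 0%N _) (pz 0%N _) (mean _ pw) (mean _ pz))
      // !pw // !pz.
  have le1N k : (k <= 1)%N -> (k <= N)%N by move=> /leq_trans; apply.
  have pU k := fun k1 => @gridU_periodic k (le1N k k1).
  have pV k := fun k1 => @gridV_periodic k (le1N k k1).
  have pu k := fun k1 => @scheme_periodic_u _ _ _ _ _ _ _ _ _ _ _ _ scheme k (le1N k k1).
  have pv k := fun k1 => @scheme_periodic_v _ _ _ _ _ _ _ _ _ _ _ _ scheme k (le1N k k1).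
  by rewrite (per _ _ pU pV) (per _ _ pu pv).
have [Q [P [res _ _]]] := ucons M_gt0 N_gt0.
have [eqQ Q0] := res j jM.
have -> : first_lhs mu gamma kappa nu h tau U V j%:Z = Q 0%N j%:Z := eqQ.
by rewrite (scheme_first scheme jM) subr0.
Qed.

Lemma main_residual k i : (k.+1 < N)%N ->
  `|main_lhs mu gamma kappa nu h tau U V k.+1 i
    - main_lhs mu gamma kappa nu h tau uh vh k.+1 i| <= c2 * (tau ^+ 2 + h ^+ 4).
Proof.
move=> kN; move: i.
apply: (@grid_periodic_bound _ _ M_gt0 (fun i => _ i - _ i)) => [i|j jM].
  have mean w : (forall l, (l <= N)%N -> grid_periodic M (w l)) ->
      grid_periodic M (fun i => (w k i + w k.+2 i) / 2 : R).
    by move=> pw {}i; rewrite !pw // !(ltnW kN, ltnW (ltnW kN)).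
  have per w z : (forall l, (l <= N)%N -> grid_periodic M (w l)) ->
      (forall l, (l <= N)%N -> grid_periodic M (z l)) ->
      main_lhs mu gamma kappa nu h tau w z k.+1 (i + M%:Z)
      = main_lhs mu gamma kappa nu h tau w z k.+1 i.
    move=> pw pz; rewrite !main_lhsE.
    have k0 : (k <= N)%N := ltnW (ltnW kN); have k1 : (k.+1 <= N)%N := ltnW kN.
    by rewrite (grid_periodic_spatial _ _ _ _ (pw _ k1) (pz _ k1) (mean _ pw) (mean _ pz))
      !(pw k) // !(pw k.+2) // !(pz k) // !(pz k.+2).
  rewrite (per _ _ gridU_periodic gridV_periodic).
  by rewrite (per _ _ (scheme_periodic_u scheme) (scheme_periodic_v scheme)).
have [Q [P [_ res _]]] := ucons M_gt0 N_gt0.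
have [eqQ Qk] := res k.+1 j kN jM.
have -> : main_lhs mu gamma kappa nu h tau U V k.+1 j%:Z = Q k.+1 j%:Z := eqQ.
by rewrite (scheme_main scheme (k := k.+1)) // subr0.
Qed.


Let B := c0 + L * (c0 + c3).
Let K1 := elliptic_const L mu.
Let Ks := lipschitz_const gamma kappa nu B * K1.
Let delta := tau ^+ 2 + h ^+ 4.
(** The size of the error after the first step: 5/2 from time 0 is multiplied by at most 1 + 4,
    [2 * c1] comes from the residual, and the last 1 ensures that the Gronwall bound dominates
    [delta]. *)
Let D := 25 / 2 * (mu * c3) + 2 * c1 + 1.
Let G := expR (8 * (Ks + c2) * T) * D.

Lemma error_bound k : (k <= N)%N -> h <= 1 -> tau <= 1 -> h ^+ 2 <= 6 * mu ->
  2 * tau * Ks <= 1 -> K1 * (G * delta) <= 1 -> err_le k (G * delta).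
Proof.
move=> kN h1 tau1 hmu tauK K1G.
have L0 : 0 <= L := ltW L_gt0.
have c00 := derivative_max_ge0.
have B0 : 0 <= B by rewrite addr_ge0 // mulr_ge0 // addr_ge0 // ltW.
have K10 : 0 < K1 by exact: elliptic_const_gt0.
have Ks0 : 0 <= Ks by rewrite mulr_ge0 ?lipschitz_const_ge0 // ltW.
have h40 : 0 <= h ^+ 4 by rewrite exprn_ge0 // ltW.
have t20 : 0 <= tau ^+ 2 by rewrite exprn_ge0 // ltW.
have d0 : 0 <= delta by rewrite addr_ge0.
have mc : 0 <= mu * c3 by rewrite mulr_ge0 // ltW.
have D1 : 1 <= D by rewrite /D; move: c1_gt0; lra.
have D0 : 0 <= D by apply: le_trans D1.
have Kc0 : 0 <= 8 * (Ks + c2) by rewrite mulr_ge0 // addr_ge0 // ltW.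
(* In [error_step] with s = 2 tau, the growth is 8 tau [Ks], and the residual 4 tau [c2 * delta] is
   absorbed as further growth because [delta <= Y l]. *)
set a := 8 * (Ks + c2) * tau.
have a0 : 0 <= a by rewrite mulr_ge0 // ltW.
pose Y l := (1 + a) ^+ l * (D * delta).
have Yd l : delta <= Y l.
  have p1 : 1 <= (1 + a) ^+ l by rewrite exprn_ege1 // lerDl.
  rewrite -[leLHS]mul1r -[X in X * _]mul1r /Y mulrA ler_wpM2r //.
  by rewrite ler_pM.
have Y0 l : 0 <= Y l by apply: le_trans (Yd l).
have YG l : (l <= N)%N -> Y l <= G * delta.
  move=> lN; rewrite /Y /G mulrA ler_wpM2r // ler_wpM2r //.
  apply: (@le_trans _ _ (expR a ^+ l)).
    by apply: lerXn2r; rewrite ?nnegrE ?expR_ge0 ?expR_ge1Dx // addr_ge0.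
  rewrite -expRM_natl ler_expR /a mulrCA ler_wpM2l //.
  by have /andP[] := grid_time lN.
have K1Y l : (l <= N)%N -> K1 * Y l <= 1.
  by move=> lN; apply: le_trans K1G; rewrite ler_pM2l // YG.
have mono k0 Y1 Y2 : Y1 <= Y2 -> err_le k0 Y1 -> err_le k0 Y2.
  by move=> Y12 e i; apply: le_trans (e i) _.
have UB l (lN : (l <= N)%N) : bounded1 h (U l) B := gridU_bounded1 lN h1.
have VB l : (l <= N)%N -> forall i, `|V l i| <= B.
  move=> lN i; apply: le_trans (gridV_bound lN i) _.
  by rewrite lerDl mulr_ge0 // addr_ge0 // ltW.
have mean l m : (l <= N)%N -> (m <= N)%N ->
    bounded1 h (fun i => (U l i + U m i) / 2) B.
  move=> lN mN; have := bounded1_mean (UB l lN) (UB m mN).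
  by have -> : (B + B) / 2 = B by field.
have E0 : err_le 0 (5 / 2 * (mu * c3) * delta).
  apply: mono grid_initial_error.
  have : mu * c3 * h ^+ 4 <= mu * c3 * delta by rewrite ler_wpM2l // lerDr.
  by lra.
have E1 : err_le 1 (Y 0%N).
  have DY : 5 / 2 * (mu * c3) * delta <= Y 0%N.
    rewrite /Y expr0 mul1r ler_wpM2r // /D; move: c1_gt0; lra.
  have K1E : K1 * (5 / 2 * (mu * c3) * delta) <= 1.
    by apply: le_trans (K1Y 0%N (leq0n _)); rewrite ler_pM2l.
  have tK : tau * Ks <= 1 / 2 by move: tauK; lra.
  have tK1 : tau * Ks <= 1 by lra.
  have C l := grid_compatible_error (k := l).
  have := error_step M_gt0 h_gt0 h1 hM mu_gt0 hmu tau_gt0 tK1 K1E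
    (UB 0%N _) (VB 0%N _) (mean 0%N 1%N _ _) (C 0%N _) (C 0%N _) (C 1%N _) E0 E0
    (q := c1 * (tau + h ^+ 4)).
  move=> step i; apply: le_trans (step _ _ _ _ _ _ _ _ i) _ => //.
    by move=> j; rewrite -!first_lhsE; exact: first_residual.
  rewrite -/Ks.
  (* The residual of the first equation is only first order in time, but it acts once, over a step
     of length [tau], and so contributes at second order. *)
  have q1 : tau * (c1 * (tau + h ^+ 4)) <= c1 * delta.
    rewrite mulrCA ler_pM2l // mulrDr -expr2 lerD2l ler_piMl //.
  have q2 : tau * Ks * (5 / 2 * (mu * c3) * delta) <= 1 * (5 / 2 * (mu * c3) * delta).
    by rewrite ler_wpM2r // mulr_ge0 // mulr_ge0 // divr_ge0.
  rewrite /Y expr0 mul1r /D; lra.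
(* The recursion has three levels, so the induction carries two consecutive errors under a common
   bound. [K1Y] keeps the middle error at most 1, as the Lipschitz estimate requires. *)
have prop l : (l < N)%N -> err_le l (Y l) /\ err_le l.+1 (Y l).
  elim: l => [|l IHl] lN.
    split=> //; apply: mono E0.
    rewrite /Y expr0 mul1r ler_wpM2r // /D; move: c1_gt0; lra.
  have [el el1] := IHl (ltnW lN).
  have YSE : Y l.+1 = (1 + a) * Y l by rewrite /Y exprS mulrA.
  have YS : Y l <= Y l.+1 by rewrite YSE ler_peMl // lerDl.
  split; first exact: mono el1.
  have t2 : 0 < 2 * tau by rewrite mulr_gt0.
  have C m := grid_compatible_error (k := m).
  have lN0 := ltnW (ltnW lN); have lN1 := ltnW lN.
  have := error_step M_gt0 h_gt0 h1 hM mu_gt0 hmu t2 tauK (K1Y l lN0)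
    (UB l.+1 lN1) (VB l.+1 lN1) (mean l l.+2 lN0 lN) (C l lN0) (C l.+1 lN1) (C l.+2 lN)
    el el1 (q := c2 * delta).
  move=> step i; apply: le_trans (step _ i) _.
    by move=> j; rewrite -!main_lhsE; exact: main_residual.
  rewrite -/Ks.
  have : 2 * tau * (c2 * delta) <= 2 * tau * (c2 * Y l).
    by rewrite ler_pM2l // ler_pM2l.
  have : 0 <= tau * (c2 * Y l).
    by apply: mulr_ge0; [exact: ltW | rewrite mulr_ge0 // ltW].
  by rewrite YSE /a; lra.
case: k kN => [|k] kN.
  exact: (mono _ _ _ (YG 0%N kN) (prop 0%N N_gt0).1).
exact: (mono _ _ _ (YG k (ltnW kN)) (prop k kN).2).
Qed.

Lemma seminorm1_error_bound k : (k <= N)%N -> h <= 1 -> tau <= 1 ->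
  h ^+ 2 <= 6 * mu -> 2 * tau * Ks <= 1 -> K1 * (G * delta) <= 1 ->
  seminorm1 M h (U k \- uh k) <= Num.sqrt L * (K1 * (G * delta)).
Proof.
move=> kN h1 tau1 hmu tauK K1G; rewrite -hM.
have [eK _] := compatible_error_bound M_gt0 h_gt0 hM mu_gt0 hmu
  (grid_compatible_error kN) (error_bound kN h1 tau1 hmu tauK K1G).
by apply: seminorm1_bound => // i; have [] := eK i.
Qed.

End ConsistentGrid.

(** * Choice of the constants and conclusion *)

Theorem theorem3 (R : realType) (L T mu gamma kappa nu : R)
    (phi : R -> R) (u : R -> R -> R) (c0 c1 c2 c3 : R)
    (L_gt0 : 0 < L) (T_gt0 : 0 < T)
    (mu_gt0 : 0 < mu) (gamma_ge0 : 0 <= gamma) (nu_neq0 : nu != 0)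
    (usol : is_bbmb_solution L T mu gamma kappa nu phi u)
    (c0max : is_derivative_max L T u c0)
    (c1_gt0 : 0 < c1) (c2_gt0 : 0 < c2) (c3_gt0 : 0 < c3)
    (ucons : is_consistent L T mu gamma kappa nu u c1 c2 c3) :
  exists h0 tau0 : R, [/\ 0 < h0, 0 < tau0 &
    let C4 := c4 L T mu gamma kappa nu c0 c1 c2 c3 h0 tau0 in
    forall M N : nat, (0 < M)%N -> (0 < N)%N ->
    let h := L / M%:R in
    let tau := T / N%:R in
    h <= h0 -> tau <= tau0 -> tau ^+ 2 + h ^+ 4 <= 1 / C4 ->
    forall uh vh : nat -> int -> R,
    is_scheme_solution mu gamma kappa nu M N h tau phi uh vh ->
    forall k : nat, (k <= N)%N ->
    seminorm1 M h (fun i => gridU h tau u k i - uh k i)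
      <= C4 * (tau ^+ 2 + h ^+ 4)].
Proof.
have c00 : 0 <= c0 := derivative_max_ge0 c0max.
pose K1 := elliptic_const L mu.
pose Ks := lipschitz_const gamma kappa nu (c0 + L * (c0 + c3)) * K1.
pose G := expR (8 * (Ks + c2) * T) * (25 / 2 * (mu * c3) + 2 * c1 + 1).
have K10 : 0 < K1 by apply: elliptic_const_gt0 => //; exact: ltW.
have G0 : 0 <= G.
  have := mulr_gt0 mu_gt0 c3_gt0 => mc.
  by rewrite /G mulr_ge0 ?expR_ge0 //; lra.
have K1G0 : 0 <= K1 * G by rewrite mulr_ge0 // ltW.
have LK0 : 0 <= Num.sqrt L * (K1 * G) by rewrite mulr_ge0 // sqrtr_ge0.
have mui0 : 0 <= (36 * mu ^+ 2)^-1 by rewrite invr_ge0 mulr_ge0 // sqr_ge0.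
have Ks20 : 0 <= (2 * Ks) ^+ 2 by rewrite sqr_ge0.
(* Each summand X gives X (tau^2 + h^4) <= 1 once [C <= C4]. In order, the first four yield tau <=
   1, h^2 <= 6 mu, 2 tau [Ks] <= 1 and the smallness of the error; the last is the constant of the
   final estimate. *)
pose C := 1 + (36 * mu ^+ 2)^-1 + (2 * Ks) ^+ 2 + K1 * G + Num.sqrt L * (K1 * G).
have C1 : 1 <= C by rewrite /C; lra.
have [tau0 tau00 C4C] := @c4_unbounded R L T mu gamma kappa nu c0 c1 c2 c3 C
  L_gt0 mu_gt0 nu_neq0 c3_gt0 (le_trans ler01 C1).
exists 1, tau0; split=> // C4 M N M_gt0 N_gt0 h tau h1 _ small uh vh scheme k kN.
set delta := tau ^+ 2 + h ^+ 4 in small *.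
have h_gt0 : 0 < h by rewrite divr_gt0 ?ltr0n.
have tau_gt0 : 0 < tau by rewrite divr_gt0 ?ltr0n.
have t20 : 0 <= tau ^+ 2 by rewrite exprn_ge0 // ltW.
have h40 : 0 <= h ^+ 4 by rewrite exprn_ge0 // ltW.
have d0 : 0 <= delta by rewrite addr_ge0.
have smallX X : X <= C -> X * delta <= 1.
  move=> XC; apply: (@le_trans _ _ (C * delta)); first by rewrite ler_wpM2r.
  apply: (@le_trans _ _ (C4 * delta)); first by rewrite ler_wpM2r.
  by rewrite mulrC -ler_pdivlMr //; apply: lt_le_trans C4C; lra.
have tau2d : tau ^+ 2 <= delta by rewrite lerDl.
have h4d : h ^+ 4 <= delta by rewrite lerDr.
have tau1 : tau <= 1.
  rewrite -(@expr_le1 _ 2) // ?(ltW tau_gt0) //; apply: le_trans tau2d _.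
  by rewrite -[delta]mul1r smallX.
have hmu : h ^+ 2 <= 6 * mu.
  rewrite -ler_sqr ?nnegrE ?exprn_ge0 ?(ltW h_gt0) ?mulr_ge0 ?(ltW mu_gt0) //.
  rewrite -exprM; apply: le_trans h4d _.
  have : (36 * mu ^+ 2)^-1 * delta <= 1 by apply: smallX; rewrite /C; lra.
  rewrite ler_pdivrMl ?mulr_gt0 ?exprn_gt0 // => /le_trans; apply.
  by rewrite exprMn; lra.
have tauK : 2 * tau * Ks <= 1.
  have [K0|/ltW K0] := ler0P Ks.
    by have := mulr_ge0_le0 (ltW tau_gt0) K0; lra.
  rewrite -(@expr_le1 _ 2) //; last by have := mulr_ge0 (ltW tau_gt0) K0; lra.
  have -> : (2 * tau * Ks) ^+ 2 = (2 * Ks) ^+ 2 * tau ^+ 2 by ring.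
  apply: le_trans (smallX ((2 * Ks) ^+ 2) _); first by rewrite ler_wpM2l.
  by rewrite /C; lra.
have K1G : K1 * (G * delta) <= 1.
  by rewrite mulrA; apply: smallX; rewrite /C; lra.
have bound : seminorm1 M h (gridU h tau u k \- uh k) <= Num.sqrt L * (K1 * (G * delta)).
  exact: (seminorm1_error_bound L_gt0 T_gt0 mu_gt0 c1_gt0 c2_gt0 c3_gt0 usol
    c0max ucons M_gt0 N_gt0 scheme kN).
apply: le_trans bound _; rewrite (mulrA K1) (mulrA (Num.sqrt L)) ler_wpM2r //.
by apply: le_trans C4C; rewrite /C; lra.
Qed.
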